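(* Let $h,\lambda>0$. The general solution of the difference inequality $$y(t+h)-\lambda y(t)\ge 0$$ is given by $$y(t)=\lambda^{t/h}\mu(t)+\sum_{s=1}^{\lfloor t\rfloor_h}\lambda^{s-1}p(t-sh),$$ where $p$ is any non-negative real-valued function and $\mu\in\mathbb{P}_h$.
   Context: Functions are real-valued functions of a real variable. $\mathbb{P}_h$ denotes the set of all functions $\mu:\mathbb{R}\to\mathbb{R}$ with $\mu(x+h)=\mu(x)$. For $h>0$, $\lfloor t\rfloor_h\in\mathbb{Z}$ is defined by $\lfloor t\rfloor_h=n$ where $t=nh+r$, $n\in\mathbb{Z}$, $0\le r<h$; equivalently $\lfloor t\rfloor_h=\lfloor t/h\rfloor$. A sum whose upper limit is smaller than its lower limit equals $0$.
   Formalization: That every solution has the given form is claimed only for t ≥ 0 (inequality and formula there); over all real t it fails, e.g. h = λ = 1, y(t) = t, since for t < 0 the sum is empty. That every function of the given form is a solution is proved for all real t. *)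

(* Defs.v *)
From HB Require Import structures.
From mathcomp Require Import all_boot all_order all_algebra.
From mathcomp Require Import all_classical all_reals all_analysis.

Set Implicit Arguments.
Unset Strict Implicit.
Unset Printing Implicit Defensive.

Import Order.TTheory GRing.Theory Num.Theory.

Local Open Scope classical_set_scope.
Local Open Scope ring_scope.

Definition periodic_functions (R : realType) (h : R) : set (R -> R) :=
  [set mu | forall x : R, mu (x + h) = mu x].

Definition floor_step (R : realType) (h t : R) : int := Num.floor (t / h).

(* The sum over 1 <= s <= n for an integer n; it is empty when n <= 0. *)
Definition sum_from1 (R : realType) (n : int) (F : nat -> R) : R :=
  match n with
  | Posz m => \sum_(1 <= s < m.+1) F s
  | Negz _ => 0
  end.

(* s ranges over s >= 1, so the truncated predecessor s.-1 is s - 1. *)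
Definition general_solution (R : realType) (h lambda : R) (mu p : R -> R)
    (t : R) : R :=
  lambda `^ (t / h) * mu t +
  sum_from1 (floor_step h t)
    (fun s : nat => lambda ^+ s.-1 * p (t - s%:R * h)).

Definition satisfies_inequality_on (R : realType) (D : set R) (h lambda : R)
    (y : R -> R) : Prop :=
  forall t : R, D t -> y (t + h) - lambda * y t >= 0.

(* Main.v *)
(* A function of the given form satisfies y (t + h) = lambda y t + p t for
   t >= 0 (with no p-term for t < 0), because raising the number of terms of the
   sum by one multiplies the old terms by lambda and adds p t. Conversely, a
   solution is determined on t >= 0 by its values on [0, h) and by the defect
   p t = y (t + h) - lambda y t; mu is chosen to match the values on [0, h). *)
Require Import Defs.
From HB Require Import structures.
From mathcomp Require Import all_boot all_order all_algebra.
From mathcomp Require Import all_classical all_reals all_analysis.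

Import Order.TTheory GRing.Theory Num.Theory.

Local Open Scope classical_set_scope.
Local Open Scope ring_scope.

Lemma floor_stepDh (R : realType) (h t : R) :
  0 < h -> floor_step h (t + h) = floor_step h t + 1.
Proof.
move=> h_gt0; rewrite /floor_step mulrDl divff ?gt_eqF //.
by rewrite floorDrz ?rpred1 // floor1.
Qed.

Lemma general_solution_step (R : realType) (h lambda : R) (mu p : R -> R)
    (t : R) :
  0 < h -> 0 < lambda -> periodic_functions h mu ->
  general_solution h lambda mu p (t + h) =
  lambda * general_solution h lambda mu p t + (if 0 <= t then p t else 0).
Proof.
move=> h_gt0 lambda_gt0 per_mu.
rewrite /general_solution floor_stepDh // per_mu mulrDr -addrA; congr (_ + _).
  rewrite mulrDl divff ?gt_eqF // powRD; last by rewrite (gt_eqF lambda_gt0) implybT.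
  by rewrite powRr1 ?ltW // mulrA [lambda * _]mulrC.
have -> : (0 <= t) = (0 <= floor_step h t).
  by rewrite floor_ge0 pmulr_lge0 ?invr_gt0.
(* The floor [-1] is split off: raised by one it becomes [Posz 0], whose sum is empty by its
   range. *)
case: (floor_step h t) => [n|[|n]] /=.
- rewrite addn1 big_nat_recl //= mul1r mul1r addrK addrC mulr_sumr; congr (_ + _).
  apply: eq_big_nat => s /andP[s_gt0 _] /=.
  rewrite mulrA -exprS prednK //; congr (_ * p _).
  by rewrite -[s.+1%:R]natr1 mulrDl mul1r opprD addrACA subrr addr0.
- by rewrite big_geq // mulr0 addr0.
- by rewrite mulr0 addr0.
Qed.

(** Finitely many shifts by [-h] bring any [t >= 0] into [[0, h)]: induction on [n] with
    [t < n%:R * h]. *)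
Lemma eq_of_step (R : realType) (h : R) (Phi : R -> R -> R) (f g : R -> R) :
  0 < h ->
  (forall t, 0 <= t -> f (t + h) = Phi t (f t)) ->
  (forall t, 0 <= t -> g (t + h) = Phi t (g t)) ->
  (forall r, 0 <= r < h -> f r = g r) ->
  forall t, 0 <= t -> f t = g t.
Proof.
move=> h_gt0 f_step g_step fg0.
suff main (n : nat) t : 0 <= t < n%:R * h -> f t = g t.
  move=> t t_ge0; apply: (main (Num.truncn (t / h)).+1).
  by rewrite t_ge0 -ltr_pdivrMr // truncnS_gt.
elim: n t => [t|n IHn t /andP[t_ge0 t_lt]].
  by rewrite mul0r => /andP[/le_lt_trans + lt0] => /(_ _ lt0); rewrite ltxx.
have [t_lth|t_geh] := ltP t h; first by apply: fg0; rewrite t_ge0.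
have th_ge0 : 0 <= t - h by rewrite subr_ge0.
rewrite -(subrK h t) f_step // g_step // IHn // th_ge0 /=.
by rewrite ltrBlDr -[X in _ + X]mul1r -mulrDl natr1.
Qed.

(* Extends [y] from [0, h) to the line so that the homogeneous part
   [lambda `^ (t / h) * mu t] agrees with [y] on [0, h). *)
Definition initial_periodic {R : realType} (h lambda : R) (y : R -> R)
    (t : R) : R :=
  let r := t - (floor_step h t)%:~R * h in (lambda `^ (r / h))^-1 * y r.

Lemma initial_periodicP (R : realType) (h lambda : R) (y : R -> R) :
  0 < h -> periodic_functions h (initial_periodic h lambda y).
Proof.
move=> h_gt0 t; rewrite /initial_periodic floor_stepDh //.
by rewrite intrD [(_ + 1) * h]mulrDl mul1r opprD addrACA subrr addr0.
Qed.

Lemma general_solution_initial (R : realType) (h lambda : R) (y p : R -> R)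
    (r : R) :
  0 < h -> 0 < lambda -> 0 <= r < h ->
  general_solution h lambda (initial_periodic h lambda y) p r = y r.
Proof.
move=> h_gt0 lambda_gt0 /andP[r_ge0 r_lth].
have r0 : floor_step h r = 0.
  by apply: floor_def; rewrite add0r divr_ge0 ?(ltW h_gt0) //= ltr_pdivrMr ?mul1r.
rewrite /general_solution /initial_periodic r0 /= big_geq // addr0.
by rewrite mul0r subr0 mulrA mulfV ?mul1r // gt_eqF // powR_gt0.
Qed.

(* The inequality with t over the whole line has solutions that are not of the
   given form at negative t, where the sum is empty: for h = lambda = 1, y t = t
   is one.  Hence completeness is stated on t >= 0, while every function of the
   given form is asserted to solve the inequality at every real t. *)
Theorem theorem3p1 (R : realType) (h lambda : R) (h_gt0 : 0 < h)
    (lambda_gt0 : 0 < lambda) :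
  (forall mu p : R -> R,
     periodic_functions h mu -> (forall x : R, 0 <= p x) ->
     satisfies_inequality_on [set: R] h lambda
       (general_solution h lambda mu p)) /\
  (forall y : R -> R,
     satisfies_inequality_on [set t : R | 0 <= t] h lambda y <->
     exists mu p : R -> R,
       [/\ periodic_functions h mu,
           (forall x : R, 0 <= p x) &
           forall t : R, 0 <= t -> y t = general_solution h lambda mu p t]).
Proof.
split=> [mu p per_mu p_ge0 t _|y].
  rewrite general_solution_step // addrC addrA addNr add0r.
  by case: ifP.
split=> [y_ineq|[mu [p [per_mu p_ge0 y_eq]]] t /= t_ge0]; last first.
  have th_ge0 : 0 <= t + h by rewrite addr_ge0 // ltW.
  rewrite !y_eq // general_solution_step // t_ge0.
  by rewrite addrC addrA addNr add0r.
(* The defect is known to be non-negative only for [t >= 0]; the value [0] elsewhere keeps [p]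
   non-negative. *)
pose p t := if 0 <= t then y (t + h) - lambda * y t else 0.
exists (initial_periodic h lambda y), p; split.
- exact: initial_periodicP.
- by move=> t; rewrite /p; case: ifPn => // t_ge0; apply: y_ineq.
- apply: (@eq_of_step _ h (fun t x => lambda * x + p t)) => // t t_ge0.
  + by rewrite /p t_ge0 [RHS]addrC subrK.
  + rewrite general_solution_step ?t_ge0 //; exact: initial_periodicP.
  + by rewrite general_solution_initial.
Qed.
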